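(* Let $G=(V,E)$ be a connected finite graph with symmetric edge weight $\omega$ and vertex measure $\mu$. Let $k\ge 1$ be an integer, let $z_1,\dots,z_k\in V$ be distinct vertices, and let $n_1,\dots,n_k$ be positive integers. Then the equation $$\Delta u=\mathrm{e}^{u}-1+4\pi\sum_{s=1}^{k} n_s\delta_{z_s}\quad\text{on } V$$ admits a unique solution $u:V\to\mathbb{R}$ if and only if $$n_1+n_2+\cdots+n_k=:N<\frac{|V|}{4\pi}.$$
   Context: $G=(V,E)$ is a connected finite graph with vertex set $V$ and edge set $E$; $y\sim x$ means $xy\in E$. The edge weight $\omega:V\times V\to[0,+\infty)$ satisfies $\omega_{xy}=\omega_{yx}$ for all $x,y\in V$, and $\omega_{xy}>0$ if and only if $x\sim y$. The vertex measure is a function $\mu:V\to(0,+\infty)$, and $|V|:=\sum_{x\in V}\mu(x)$ denotes the volume of $V$ (not the number of vertices). For $u:V\to\mathbb{R}$, the Laplacian is $\Delta u(x)=\frac{1}{\mu(x)}\sum_{y\sim x}\omega_{yx}(u(y)-u(x))$. For a vertex $z$, the Dirac mass is $\delta_z(x)=\frac{1}{\mu(z)}$ if $x=z$ and $\delta_z(x)=0$ otherwise. *)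

(* Defs.v *)
From mathcomp Require Import all_boot all_order all_algebra.
From mathcomp Require Import reals.
Import Order.TTheory GRing.Theory Num.Theory.

Set Implicit Arguments.
Unset Strict Implicit.
Unset Printing Implicit Defensive.

Local Open Scope ring_scope.

(* A graph on the finite type V is given by its adjacency relation e.
   Self-loops are not excluded: their terms in [laplacian] vanish. *)
Definition connected_graph (V : finType) (e : rel V) : Prop :=
  symmetric e /\ forall x y : V, connect e x y.

Definition edge_weight (R : realType) (V : finType) (e : rel V)
    (w : V -> V -> R) : Prop :=
  [/\ forall x y, 0 <= w x y,
      forall x y, w x y = w y x
    & forall x y, 0 < w x y <-> e x y].

Definition vertex_measure (R : realType) (V : finType) (mu : V -> R) : Prop :=
  forall x, 0 < mu x.

Definition volume (R : realType) (V : finType) (mu : V -> R) : R :=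
  \sum_(x : V) mu x.

Definition laplacian (R : realType) (V : finType) (e : rel V)
    (w : V -> V -> R) (mu : V -> R) (u : V -> R) (x : V) : R :=
  (mu x)^-1 * \sum_(y : V | e y x) w y x * (u y - u x).

Definition dirac_mass (R : realType) (V : finType) (mu : V -> R)
    (z x : V) : R :=
  if x == z then (mu z)^-1 else 0.

(* Main.v *)
Require Import Defs.
From mathcomp Require Import all_boot all_order all_algebra.
From mathcomp Require Import reals sequences exp trigo.
From mathcomp Require Import boolp classical_sets topology normedtype.
From mathcomp Require Import ring lra.
Import Order.TTheory GRing.Theory Num.Theory.
Import numFieldNormedType.Exports.

Local Open Scope ring_scope.

(** Write the equation as [Delta u = e^u - h] with [h = 1 - 4 pi sum_s n_s
    delta_(z_s)].  The sum of [mu * h] over [V] is [volume mu - 4 pi N], so the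
    theorem says that the equation is uniquely solvable exactly when [h] has
    positive integral ([exp_equation_solvable]).

    Necessity: the integral of a Laplacian is zero ([sum_flow_eq0]), so a
    solution satisfies [int h = int e^u > 0].

    Uniqueness: at a vertex where [v - u] is maximal the Laplacian of [v - u]
    is nonpositive, which forces [e^v <= e^u] there when [v] is a subsolution
    and [u] a supersolution; hence [v <= u] everywhere ([comparison]).

    Existence is Perron's method ([perron]).  Subsolutions are bounded above by
    a constant supersolution, and their pointwise supremum [u] is a solution:
    freezing the neighbours of a vertex [x], the equation at [x] becomes a
    scalar equation [d x * t + mu x * e^t = A], with an increasing left-hand
    side, whose root [t] is both an upper bound of the values at [x] of the
    subsolutions and the value at [x] of a subsolution.  It remains to
    produce one subsolution.  If [a > 0] is the mean of [h], the Poisson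
    equation [Delta phi = a - h] has a solution, because its right-hand side
    has zero integral and so is orthogonal to the kernel of the symmetric
    operator [mu * Delta], made of the constants on a connected graph
    ([poisson]); for a large constant [K], [e^(phi - K) <= a], so [phi - K] is
    a subsolution. *)

Section Flow.
Set Implicit Arguments.
Unset Strict Implicit.

Variables (R : realType) (V : finType) (w : V -> V -> R).
Hypothesis w_ge0 : forall x y, 0 <= w x y.
Hypothesis w_sym : forall x y, w x y = w y x.

(** * The Laplacian without its normalization by the vertex measure *)

(** This is [mu * Delta u], which unlike [Delta] is symmetric for the counting
    measure. *)
Definition flow (u : V -> R) (x : V) : R := \sum_y w y x * (u y - u x).

Lemma sum_flow_eq0 (u : V -> R) : \sum_x flow u x = 0.
Proof.
(* Exchanging the two summations changes the sign of the double sum. *)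
suff : \sum_x flow u x = - \sum_x flow u x by move=> h; lra.
rewrite -sumrN {1}/flow exchange_big; apply: eq_bigr => x _ /=.
by rewrite /flow -sumrN; apply: eq_bigr => y _; rewrite (w_sym x y); ring.
Qed.

Lemma flow_le0_at_max (f : V -> R) x :
  (forall y, f y <= f x) -> flow f x <= 0.
Proof.
by move=> fx; apply: sumr_le0 => y _; rewrite mulr_ge0_le0 // subr_le0.
Qed.

Lemma flowB (u v : V -> R) x :
  flow (fun y => u y - v y) x = flow u x - flow v x.
Proof. by rewrite /flow -sumrB; apply: eq_bigr => y _; ring. Qed.

Lemma flow_cst (c : R) x : flow (fun=> c) x = 0.
Proof. by apply: big1 => y _; rewrite subrr mulr0. Qed.

Lemma max_vertex (f : V -> R) (x0 : V) : exists x, forall y, f y <= f x.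
Proof.
by case: (@Order.TotalTheory.arg_maxP _ _ _ x0 xpredT f isT) => x _ fx;
  exists x => y; apply: fx.
Qed.

(** * The Poisson equation *)

(** Strong maximum principle: the vertices where a harmonic function is maximal
    are closed under adjacency. *)
Lemma harmonic_constant (e : rel V) (f : V -> R) :
  connected_graph e -> (forall x y, e x y -> 0 < w x y) ->
  (forall x, flow f x = 0) -> forall x y, f x = f y.
Proof.
move=> [e_sym e_conn] ew f0 x y.
have [m fm] := max_vertex f x.
have step a b : e a b -> a \in [pred c | f c == f m] ->
    b \in [pred c | f c == f m].
  rewrite !inE => eab /eqP fa.
  have pos c : true -> 0 <= w c a * (f a - f c).
    by move=> _; rewrite mulr_ge0 // subr_ge0 fa.
  have s0 : \sum_c w c a * (f a - f c) = 0.
    have -> : \sum_c w c a * (f a - f c) = - flow f a.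
      by rewrite /flow -sumrN; apply: eq_bigr => c _; ring.
    by rewrite f0 oppr0.
  have /eqP := psumr_eq0P pos s0 (i := b) isT.
  by rewrite mulf_eq0 gt_eqF ?ew 1?e_sym //= subr_eq0 eq_sym -fa.
have all_max c : f c = f m.
  have := closed_connect (intro_closed (sym_connect_sym e_sym) step)
    (e_conn m c).
  by rewrite !inE eqxx => /esym/eqP.
by rewrite !all_max.
Qed.

(** The matrix of [flow] is symmetric, so the columns of its cokernel matrix
    are harmonic functions; since these are constant, the row space of the
    matrix contains every vector of zero sum. *)
Lemma poisson (e : rel V) (g : V -> R) :
  connected_graph e -> (forall x y, e x y -> 0 < w x y) ->
  \sum_x g x = 0 -> exists phi, forall x, flow phi x = g x.
Proof.
move=> e_conn ew g0.
pose deg x := \sum_y w y x.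
pose ev := @enum_val V V.
pose A : 'M[R]_#|V| :=
  \matrix_(i, j) (w (ev i) (ev j) - (i == j)%:R * deg (ev j)).
have sumV (F : V -> R) : \sum_(i < #|V|) F (ev i) = \sum_x F x.
  by rewrite (reindex _ (onW_bij _ (@enum_val_bij V))).
have flowA (u : V -> R) j : \sum_i u (ev i) * A i j = flow u (ev j).
  have -> : flow u (ev j) =
      \sum_y w y (ev j) * u y - u (ev j) * deg (ev j).
    by rewrite /flow /deg mulr_sumr -sumrB; apply: eq_bigr => y _; ring.
  rewrite -(sumV (fun y => w y (ev j) * u y)).
  rewrite (eq_bigr (fun i => w (ev i) (ev j) * u (ev i)
    - (i == j)%:R * (u (ev i) * deg (ev j)))); last first.
    by move=> i _; rewrite mxE; ring.
  rewrite sumrB; congr (_ - _).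
  rewrite (bigD1 j) //= eqxx mul1r big1 ?addr0 // => i /negPf ->.
  by rewrite mul0r.
have A_sym i j : A i j = A j i.
  rewrite !mxE w_sym eq_sym; congr (_ - _).
  by case: eqP => [->|] //; rewrite !mul0r.
have coker_harmonic k x :
    flow (fun y => cokermx A (enum_rank y) k) x = 0.
  rewrite -(enum_rankK x) -/(ev _) -flowA.
  have /matrixP/(_ (enum_rank x) k) := mulmx_coker A.
  rewrite [in X in X -> _]mxE [in X in X -> _]mxE.
  apply: etrans; apply: eq_bigr => i _.
  by rewrite enum_valK mulrC A_sym.
have : (\row_i g (ev i) <= A)%MS.
  rewrite submxE; apply/eqP/matrixP => i k; rewrite !mxE.
  have coker_cst := harmonic_constant e_conn ew (coker_harmonic k).
  case: (pickP V) => [x0 _|V0]; last first.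
    by apply: big1 => l _; have := V0 (ev l).
  rewrite (eq_bigr (fun l => g (ev l) * cokermx A (enum_rank x0) k)).
    by rewrite -mulr_suml (sumV g) g0 mul0r.
  by move=> l _; rewrite mxE -(coker_cst (ev l)) enum_valK.
case/submxP => D /rowP gD.
exists (fun x => D 0 (enum_rank x)) => x.
have -> : g x = (D *m A) 0 (enum_rank x).
  by rewrite -gD mxE /ev enum_rankK.
rewrite [RHS]mxE -[X in flow _ X](enum_rankK x) -/(ev _) -flowA.
by apply: eq_bigr => i _; rewrite enum_valK.
Qed.

(** * Sub- and supersolutions *)

Variable mu : V -> R.
Hypothesis mu_gt0 : forall x, 0 < mu x.
Variable h : V -> R.

Definition subsolution (v : V -> R) :=
  forall x, mu x * (expR (v x) - h x) <= flow v x.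

Definition supersolution (v : V -> R) :=
  forall x, flow v x <= mu x * (expR (v x) - h x).

Definition solution (v : V -> R) :=
  forall x, flow v x = mu x * (expR (v x) - h x).

Lemma comparison u v :
  subsolution v -> supersolution u -> forall x, v x <= u x.
Proof.
move=> vsub usup x.
have [m vm] := max_vertex (fun y => v y - u y) x.
have := flow_le0_at_max vm; rewrite flowB => fle.
have : mu m * (expR (v m) - h m) <= mu m * (expR (u m) - h m).
  by apply: le_trans (usup m); apply: le_trans (vsub m) _; rewrite -subr_le0.
rewrite ler_pM2l // lerD2r ler_expR => vum.
by have := vm x; lra.
Qed.

Lemma constant_supersolution : supersolution (fun=> \sum_y `|h y|).
Proof.
move=> x; rewrite flow_cst; apply: mulr_ge0; first exact: ltW.
rewrite subr_ge0; apply: le_trans (expR_ge1Dx _).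
have : h x <= \sum_y `|h y|; last by lra.
rewrite (bigD1 x) //=; apply: le_trans (ler_norm _) _.
by rewrite lerDl sumr_ge0.
Qed.

Lemma solution_unique u v : solution u -> solution v -> u = v.
Proof.
move=> us vs; apply: funext => x; apply/eqP; rewrite eq_le.
by apply/andP; split; apply: comparison => y; rewrite (us, vs).
Qed.

(** * Perron's method *)

(** A loop at [x] contributes nothing to the flow; it is left out so that
    the inflow does not depend on the value at [x]. *)
Definition inflow (u : V -> R) x := \sum_(y | y != x) w y x * u y.
Definition outdeg x := \sum_(y | y != x) w y x.

(** The part of the equation at [x] that depends on the value [t] taken
    there. *)
Definition local_lhs x (t : R) := outdeg x * t + mu x * expR t.

Lemma flowE u x : flow u x = inflow u x - outdeg x * u x.
Proof.
rewrite /flow (bigD1 x) //= subrr mulr0 add0r /inflow /outdeg mulr_suml.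
by rewrite -sumrB; apply: eq_bigr => y _; ring.
Qed.

Lemma subsolutionE v :
  subsolution v <-> forall x, local_lhs x (v x) <= inflow v x + mu x * h x.
Proof.
by split=> vs x; have := vs x; rewrite flowE /local_lhs; lra.
Qed.

Lemma inflow_le u v x :
  (forall y, y != x -> u y <= v y) -> inflow u x <= inflow v x.
Proof. by move=> uv; apply: ler_sum => y yx; rewrite ler_wpM2l ?uv. Qed.

Lemma outdeg_ge0 x : 0 <= outdeg x.
Proof. exact: sumr_ge0. Qed.

Lemma local_lhs_le x s t : s <= t -> local_lhs x s <= local_lhs x t.
Proof.
by move=> st; rewrite lerD // ler_wpM2l ?outdeg_ge0 ?ler_expR // ltW.
Qed.

Lemma local_lhs_lt x s t : s < t -> local_lhs x s < local_lhs x t.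
Proof.
move=> st; rewrite ler_ltD // ?ltr_pM2l ?ltr_expR //.
by rewrite ler_wpM2l ?outdeg_ge0 ?ltW.
Qed.

(** Some value [s] with [local_lhs x s <= A] has to be given: if [x] has no
    neighbour besides itself, [local_lhs x] takes only positive values. *)
Lemma local_lhs_onto x s A :
  local_lhs x s <= A -> exists t, local_lhs x t = A.
Proof.
move=> sA.
(* [expR T >= 1 + T] makes the value at this point at least [A]. *)
pose T := Num.max s (`|A| / mu x).
have sT : s <= T by rewrite le_max lexx.
have T_ge : `|A| / mu x <= T by rewrite le_max lexx orbT.
have T_ge0 : 0 <= T.
  by apply: le_trans T_ge; rewrite divr_ge0 // ltW.
have AT : A <= local_lhs x T.
  apply: le_trans (ler_norm A) _; rewrite ler_pdivrMr // in T_ge.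
  apply: (le_trans T_ge); rewrite mulrC /local_lhs -[leLHS]add0r.
  rewrite lerD ?mulr_ge0 ?outdeg_ge0 // ler_pM2l //.
  by apply: le_trans (expR_ge1Dx _); lra.
have [] := @IVT R (local_lhs x) s T A sT; last by move=> t _ <-; exists t.
  apply: continuous_subspaceT => t; apply: cvgD; apply: cvgM.
  - exact: cvg_cst.
  - exact: cvg_id.
  - exact: cvg_cst.
  - exact: continuous_expR.
by rewrite ge_min sA /= le_max AT orbT.
Qed.

(** The root [t] of the equation at [x] in which the neighbours carry the
    values of the supremum [u] is an upper bound for the subsolutions at [x]
    by monotonicity, so [u x <= t], and [u] is itself a subsolution.  Hence so
    is [u] with its value at [x] raised to [t], and [t <= u x]. *)
Lemma perron v0 : subsolution v0 -> exists u, solution u.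
Proof.
move=> v0_sub.
pose vals x := [set r | exists2 v, subsolution v & r = v x]%classic.
pose u x := sup (vals x).
have le_u v x : subsolution v -> v x <= u x.
  move=> v_sub; apply: ub_le_sup; last by exists v.
  exists (\sum_y `|h y|) => _ [v' v'_sub ->].
  exact: comparison v'_sub constant_supersolution x.
have u_le x t : (forall v, subsolution v -> v x <= t) -> u x <= t.
  move=> bnd; apply: ge_sup; first by exists (v0 x), v0.
  by move=> _ [v v_sub ->]; apply: bnd.
pose A x := inflow u x + mu x * h x.
have lhs_le v x : subsolution v -> local_lhs x (v x) <= A x.
  move=> v_sub; apply: le_trans ((subsolutionE v).1 v_sub x) _.
  by rewrite lerD2r inflow_le // => y _; apply: le_u.
have root x : exists2 t, local_lhs x t = A x & u x <= t.
  have [t tA] := local_lhs_onto (lhs_le v0 x v0_sub); exists t => //.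
  apply: u_le => v v_sub; rewrite leNgt; apply/negP => /(local_lhs_lt x).
  by rewrite tA ltNge lhs_le.
have u_sub : subsolution u.
  apply/subsolutionE => x; have [t tA ut] := root x.
  by rewrite -/(A x) -tA local_lhs_le.
exists u => x; have [t tA ut] := root x.
pose u' y := if y == x then t else u y.
have u'_sub : subsolution u'.
  apply/subsolutionE => y; rewrite {1}/u'; case: eqP => [->|/eqP yx].
    rewrite tA lerD2r inflow_le // => z /negPf zx.
    by rewrite /u' zx.
  apply: le_trans ((subsolutionE u).1 u_sub y) _.
  rewrite lerD2r inflow_le // => z _.
  by rewrite /u'; case: eqP => [->|].
have tu : u x = t.
  apply/eqP; rewrite eq_le ut /=.
  by have := le_u _ x u'_sub; rewrite /u' eqxx.
by move: tA; rewrite flowE /A /local_lhs -tu; lra.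
Qed.

(** * Solvability of the exponential equation *)

Lemma subsolution_exists (e : rel V) :
  connected_graph e -> (forall x y, e x y -> 0 < w x y) ->
  0 < \sum_x mu x * h x -> exists v, subsolution v.
Proof.
move=> e_conn ew h_pos.
pose vol := \sum_x mu x.
have vol_gt0 : 0 < vol.
  rewrite lt_def sumr_ge0 ?andbT => [|x _]; last exact: ltW.
  apply: contraTneq h_pos => vol0; rewrite big1 ?ltxx // => x _.
  have := psumr_eq0P (fun y _ => ltW (mu_gt0 y)) vol0 (i := x) isT.
  by move=> ->; rewrite mul0r.
pose a := (\sum_x mu x * h x) / vol.
have a_gt0 : 0 < a by rewrite divr_gt0.
have [|phi phiE] := @poisson e (fun x => mu x * (a - h x)) e_conn ew.
  rewrite (eq_bigr (fun x => mu x * a - mu x * h x)) => [|x _]; last by ring.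
  by rewrite sumrB -mulr_suml mulrC divfK ?subrr // gt_eqF.
pose K := \sum_y `|phi y| - ln a.
exists (fun x => phi x - K) => x.
rewrite (flowB phi (fun=> K)) flow_cst subr0 phiE ler_pM2l // lerD2r.
rewrite -[leRHS]lnK ?posrE // ler_expR /K opprB.
have : phi x <= \sum_y `|phi y|; last by lra.
rewrite (bigD1 x) //=; apply: le_trans (ler_norm _) _.
by rewrite lerDl sumr_ge0.
Qed.

Lemma exp_equation_solvable (e : rel V) (x0 : V) :
  connected_graph e -> (forall x y, e x y -> 0 < w x y) ->
  (exists! u, solution u) <-> 0 < \sum_x mu x * h x.
Proof.
move=> e_conn ew; split=> [[u [u_sol _]]|h_pos].
  have -> : \sum_x mu x * h x = \sum_x mu x * expR (u x).
    apply/esym/eqP; rewrite -subr_eq0 -sumrB; apply/eqP.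
    rewrite -[RHS](sum_flow_eq0 u).
    by apply: eq_bigr => x _; rewrite u_sol; ring.
  rewrite (bigD1 x0) //= ltr_pwDl ?mulr_gt0 ?expR_gt0 //.
  by apply: sumr_ge0 => x _; rewrite mulr_ge0 ?expR_ge0 ?ltW.
have [v v_sub] := subsolution_exists e_conn ew h_pos.
have [u u_sol] := perron v_sub.
by exists u; split=> // u' u'_sol; apply: solution_unique.
Qed.

End Flow.

(** * The Laplacian and the Dirac masses *)

(** The sum may run over all vertices because the weight vanishes off the
    edges. *)
Lemma measure_laplacian (R : realType) (V : finType) (e : rel V)
    (w : V -> V -> R) (mu u : V -> R) (x : V) :
  edge_weight e w -> vertex_measure mu ->
  mu x * laplacian e w mu u x = flow w u x.
Proof.
move=> [w_ge0 _ w_e] mu_gt0.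
rewrite /laplacian mulrA mulfV ?gt_eqF // mul1r big_mkcond.
apply: eq_bigr => y _; case: ifPn => // ney.
suff -> : w y x = 0 by rewrite mul0r.
apply/eqP; rewrite eq_le w_ge0 andbT leNgt.
by apply: contra ney => /w_e.
Qed.

Lemma integral_dirac_mass (R : realType) (V : finType) (mu : V -> R)
    (z : V) : vertex_measure mu -> \sum_x mu x * dirac_mass mu z x = 1.
Proof.
move=> mu_gt0; rewrite (bigD1 z) //= big1 => [|x /negPf xz].
  by rewrite /dirac_mass eqxx addr0 mulfV // gt_eqF.
by rewrite /dirac_mass xz mulr0.
Qed.

Theorem theorem2p5 (R : realType) (V : finType) (e : rel V)
    (w : V -> V -> R) (mu : V -> R)
    (G_conn : connected_graph e)
    (w_weight : edge_weight e w)
    (mu_meas : vertex_measure mu)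
    (k : nat) (k_ge1 : (1 <= k)%N)
    (z : 'I_k -> V) (z_inj : injective z)
    (n : 'I_k -> nat) (n_gt0 : forall s, (0 < n s)%N) :
  (exists! u : V -> R, forall x : V,
     laplacian e w mu u x =
       expR (u x) - 1
       + 4 * pi * \sum_(s < k) (n s)%:R * dirac_mass mu (z s) x)
  <-> ((\sum_(s < k) n s)%N)%:R < volume mu / (4 * pi).
Proof.
pose src x : R := \sum_(s < k) (n s)%:R * dirac_mass mu (z s) x.
pose h x : R := 1 - 4 * pi * src x.
have [w_ge0 w_sym w_e] := w_weight.
have solE (u : V -> R) :
    (forall x, laplacian e w mu u x = expR (u x) - 1 + 4 * pi * src x)
    = solution w mu h u.
  apply: propext; rewrite /solution /h.
  split=> eqn x; have := eqn x;
    rewrite -(measure_laplacian u x w_weight mu_meas).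
    by move=> ->; ring.
  have mu0 : mu x != 0 by rewrite gt_eqF.
  by move/(mulfI mu0) => ->; ring.
have int_src : \sum_x mu x * src x = (\sum_(s < k) n s)%N%:R.
  rewrite natr_sum.
  under [LHS]eq_bigr do rewrite /src mulr_sumr.
  rewrite exchange_big; apply: eq_bigr => s _ /=.
  under eq_bigr do rewrite mulrCA.
  by rewrite -mulr_sumr integral_dirac_mass // mulr1.
have int_h : \sum_x mu x * h x = volume mu - 4 * pi * (\sum_(s < k) n s)%N%:R.
  rewrite -int_src mulr_sumr -sumrB.
  by apply: eq_bigr => x _; rewrite /h; ring.
have pi4 : 0 < 4 * pi :> R by rewrite mulr_gt0 ?pi_gt0.
rewrite ltr_pdivlMr // [X in X < _]mulrC -subr_gt0 -int_h.
rewrite -(exp_equation_solvable w_ge0 w_sym mu_meas h (z (Ordinal k_ge1))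
  G_conn (fun x y => (w_e x y).2)).
by split=> -[u [u_sol u_uniq]]; exists u; split=> [|u'];
  [rewrite -solE|rewrite -solE; apply: u_uniq
  |rewrite solE|rewrite solE; apply: u_uniq].
Qed.
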